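(* Suppose $E:\mathcal{P}_{2,\omega_0}(\mathbb{R}^d)\to\mathbb{R}\cup\{+\infty\}$ is proper, coercive, lower semicontinuous and $\lambda$-convex along generalized geodesics for some $\lambda\in\mathbb{R}$. Then for $\mu\in D(|\partial E|)$, $0<h\le\tau<\frac1{\lambda^-}$ and integers $n,m\ge0$, $$W_2^2(J^n_\tau\mu,J^m_h\mu)\le\big[(n\tau-mh)^2+\tau hm+2\tau^2n\big](1-\lambda^-\tau)^{-2n}(1-\lambda^-h)^{-2m}|\partial E|^2(\mu).$$
   Context: Fix a probability measure $\omega_0$ on $\mathbb{R}^d$. $W_2$ is the quadratic Wasserstein distance, $\Gamma_0(\mu,\nu)$ the optimal couplings; $\mathcal{P}_{2,\omega_0}(\mathbb{R}^d)=\{\mu:W_2(\mu,\omega_0)<\infty\}$. A transport plan from $\mu_0$ to $\mu_1$ with base $\omega$ is $\boldsymbol\omega\in\mathcal{P}((\mathbb{R}^d)^3)$ with $\pi^{1,2}\#\boldsymbol\omega\in\Gamma_0(\omega,\mu_0)$, $\pi^{1,3}\#\boldsymbol\omega\in\Gamma_0(\omega,\mu_1)$; generalized geodesic $\mu_\alpha=((1-\alpha)\pi^2+\alpha\pi^3)\#\boldsymbol\omega$; $W_{2,\boldsymbol\omega}(\mu_0,\mu_1)=(\int|x_2-x_3|^2d\boldsymbol\omega)^{1/2}$. $D(E)=\{E<\infty\}$; proper: $D(E)\ne\emptyset$; coercive: $\exists\tau_0>0,u_0$ with $\inf_v\{\frac1{2\tau_0}W_2^2(u_0,v)+E(v)\}>-\infty$;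 lower semicontinuous w.r.t. $W_2$; $\lambda$-convex along generalized geodesics: for all $\mu_0,\mu_1,\omega$ there is a generalized geodesic from $\mu_0$ to $\mu_1$ with base $\omega$ (induced by some $\boldsymbol\omega$) with $E(\mu_\alpha)\le(1-\alpha)E(\mu_0)+\alpha E(\mu_1)-\alpha(1-\alpha)\frac\lambda2W^2_{2,\boldsymbol\omega}(\mu_0,\mu_1)$. $\lambda^-=\max\{0,-\lambda\}$, $1/\lambda^-=+\infty$ if $\lambda^-=0$. $J_\tau\mu=\operatorname{argmin}_\nu\{\frac1{2\tau}W_2^2(\mu,\nu)+E(\nu)\}$, $J^n_\tau$ its $n$-fold iterate, $J^0_\tau\mu=\mu$. Metric slope $|\partial E|(\mu)=\limsup_{\nu\to\mu}(E(\mu)-E(\nu))^+/W_2(\mu,\nu)$; $D(|\partial E|)=\{\mu\in D(E):|\partial E|(\mu)<\infty\}$. *)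

(* Defs.v *)
From HB Require Import structures.
From mathcomp Require Import all_boot all_order all_algebra.
From mathcomp Require Import all_classical all_reals all_analysis.
Set Implicit Arguments. Unset Strict Implicit. Unset Printing Implicit Defensive.
Import Order.TTheory GRing.Theory Num.Theory.
Import numFieldNormedType.Exports.
Local Open Scope classical_set_scope.
Local Open Scope ring_scope.

Definition Rd (R : realType) (d : nat) : measurableType _ :=
  g_sigma_algebraType (@open ('rV[R]_d)).

Definition sqdist (R : realType) (d : nat) (x y : 'rV[R]_d) : R :=
  \sum_(i < d) (x ord0 i - y ord0 i) ^+ 2.

Local Open Scope ereal_scope.

Section Wasserstein.
Context (R : realType) (d : nat).
Notation V := (Rd R d).
Notation P := (probability V R).

Definition is_coupling (mu nu : P) (g : set (V * V) -> \bar R) : Prop :=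
  (forall A, measurable A -> g (A `*` setT) = mu A) /\
  (forall B, measurable B -> g (setT `*` B) = nu B).

Definition cost2 (g : set (V * V) -> \bar R) : \bar R :=
  \int[g]_x (sqdist (x.1 : 'rV[R]_d) (x.2 : 'rV[R]_d))%:E.

Definition W2sq (mu nu : P) : \bar R :=
  ereal_inf [set cost2 g | g in
     [set g : probability (V * V)%type R | is_coupling mu nu g]].

Definition W2 (mu nu : P) : \bar R :=
  match W2sq mu nu with
  | EFin r => (Num.sqrt r)%:E
  | +oo => +oo
  | -oo => -oo
  end.

Definition is_opt_coupling (mu nu : P) (g : set (V * V) -> \bar R) : Prop :=
  is_coupling mu nu g /\ cost2 g = W2sq mu nu.

Definition P2 (om0 mu : P) : Prop := W2 mu om0 < +oo.

Definition pi12 (x : V * V * V) : V * V := (x.1.1, x.1.2).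
Definition pi13 (x : V * V * V) : V * V := (x.1.1, x.2).

Definition is_plan (om mu0 mu1 : P) (w : probability (V * V * V)%type R) : Prop :=
  is_opt_coupling om mu0 (pushforward w pi12) /\
  is_opt_coupling om mu1 (pushforward w pi13).

Definition interp (a : R) (x : V * V * V) : V :=
  ((1 - a)%R *: (x.1.2 : 'rV[R]_d) + a *: (x.2 : 'rV[R]_d))%R.

Definition W2plan_sq (w : probability (V * V * V)%type R) : \bar R :=
  \int[w]_x (sqdist (x.1.2 : 'rV[R]_d) (x.2 : 'rV[R]_d))%:E.

(* Properties of E : P_{2,om0} -> R \cup {+oo}; E is given on all
   probability measures but only its values on P_{2,om0} matter. *)
Definition values_in_Rpinfty (om0 : P) (E : P -> \bar R) : Prop :=
  forall mu, P2 om0 mu -> E mu != -oo.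

Definition E_proper (om0 : P) (E : P -> \bar R) : Prop :=
  exists mu, P2 om0 mu /\ E mu < +oo.

Definition coercive (om0 : P) (E : P -> \bar R) : Prop :=
  exists tau0 : R, (0 < tau0)%R /\ exists u0, P2 om0 u0 /\
    -oo < ereal_inf [set ((2 * tau0)^-1)%:E * W2sq u0 v + E v | v in P2 om0].

Definition W2_lsc (om0 : P) (E : P -> \bar R) : Prop :=
  forall mu, P2 om0 mu -> forall r : R, r%:E < E mu ->
    exists delta : R, (0 < delta)%R /\
      forall nu, P2 om0 nu -> W2 mu nu < delta%:E -> r%:E < E nu.

Definition convex_gen_geod (om0 : P) (lam : R) (E : P -> \bar R) : Prop :=
  forall mu0 mu1 om, P2 om0 mu0 -> P2 om0 mu1 -> P2 om0 om ->
    exists w, is_plan om mu0 mu1 w /\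
      forall a : R, (0 <= a <= 1)%R ->
        forall mua : P, P2 om0 mua ->
          (forall A, measurable A -> mua A = pushforward w (interp a) A) ->
          E mua <= ((1 - a)%R)%:E * E mu0 + a%:E * E mu1
                   - (a * (1 - a) * lam / 2)%:E * W2plan_sq w.

(* nu is a minimizer of nu |-> W_2^2(mu,nu)/(2 tau) + E(nu): nu = J_tau mu *)
Definition is_prox (om0 : P) (E : P -> \bar R) (tau : R) (mu nu : P) : Prop :=
  P2 om0 nu /\
  forall v, P2 om0 v ->
    ((2 * tau)^-1)%:E * W2sq mu nu + E nu <= ((2 * tau)^-1)%:E * W2sq mu v + E v.

(* s k = J_tau^k mu for all k *)
Definition is_JKO_seq (om0 : P) (E : P -> \bar R) (tau : R) (mu : P)
    (s : nat -> P) : Prop :=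
  s 0%N = mu /\ forall k, is_prox om0 E tau (s k) (s k.+1).

Definition slope (om0 : P) (E : P -> \bar R) (mu : P) : \bar R :=
  ereal_inf [set ereal_sup [set maxe (E mu - E nu) 0 * ((fine (W2 mu nu))^-1)%:E
                 | nu in [set nu | P2 om0 nu /\ 0 < W2 mu nu < delta%:E]]
            | delta in [set delta : R | (0 < delta)%R]].

Definition in_dom_slope (om0 : P) (E : P -> \bar R) (mu : P) : Prop :=
  [/\ P2 om0 mu, E mu < +oo & slope om0 E mu < +oo].

End Wasserstein.

Definition lam_minus (R : realType) (lam : R) : R := Num.max 0%R (- lam)%R.

Definition inv_lam_minus (R : realType) (lam : R) : \bar R :=
  if lam_minus lam == 0%R then +oo else ((lam_minus lam)^-1)%:E.

(* Main.v *)
(* Writing [x' = J_tau x], minimality of [x'] against the interpolants of a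
   generalized geodesic with base [x] from [x'] to [v] gives the discrete
   evolution variational inequality
     (1 + lam tau) W^2(x', v) <= W^2(x, v) - W^2(x, x') + 2 tau (E v - E x').
   Adding [h] times this inequality at [v = J_h^m mu] (for a [tau]-step) and
   [tau] times it at [v = J_tau^n mu] (for an [h]-step) cancels the energies:
   with [a n m = W^2(J_tau^n mu, J_h^m mu)] and [k = lam^-],
     (tau + h - 2 k h tau) a n m <= tau a n (m-1) + h a (n-1) m.
   The weight ((n tau - m h)^2 + n tau^2 + m h^2) (1 - k tau)^(-2n)
   (1 - k h)^(-2m) is a supersolution of this recursion, and the boundary values
   [a n 0], [a 0 m] are controlled by the slope at [mu] and the triangle
   inequality.

   The triangle inequality for [W2] on P_{2,om0}, and the existence of optimal
   plans, come from the convexity hypothesis itself, which provides a plan with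
   any base.  Only the membership of interpolants in P_{2,om0} needs a separate
   gluing of couplings; since mere finiteness of the cost is at stake, gluing
   along a countable partition into bounded cells suffices. *)

Require Import Defs.
From HB Require Import structures.
From mathcomp Require Import all_boot all_order all_algebra.
From mathcomp Require Import all_classical all_reals all_analysis.
From mathcomp Require Import measurable_realfun ring lra.
Import Order.TTheory GRing.Theory Num.Theory.
Import numFieldNormedType.Exports.
Local Open Scope classical_set_scope.
Local Open Scope ring_scope.
Local Open Scope ereal_scope.
Set Implicit Arguments. Unset Strict Implicit. Unset Printing Implicit Defensive.

(** * Gluing along a countable partition *)

Section mixture.
Context (disp : measure_display) (T : measurableType disp) (R : realType).

Lemma mixture_exists (a : nat -> {nonneg R}) (P : nat -> probability T R) :
  \sum_(0 <= k <oo) ((a k)%:num)%:E = 1 ->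
  exists M : probability T R, forall A,
    M A = \sum_(0 <= k <oo) ((a k)%:num)%:E * P k A.
Proof.
move=> a1; pose m := mseries (fun k => mscale (a k) (P k)) 0.
have mT : m setT = 1.
  by rewrite -a1 /m /mseries; apply: eq_eseriesr => k _;
    rewrite /= /mscale/= probability_setT mule1.
pose mix := Measure_isProbability.Build _ _ _ m mT.
by exists (HB.pack_for (probability T R) m mix).
Qed.

(** Stated multiplicatively so that null cells are included: [mnormalize] falls back on [g] itself
    when [g D] is zero, and both sides of the first claim then vanish. *)
Lemma conditioning_exists (g : probability T R) (D : set T) : measurable D ->
  exists P : probability T R,
    (forall C, measurable C -> g (C `&` D) = g D * P C) /\
    (0 < g D -> P (~` D) = 0).
Proof.
move=> mD; exists (mnormalize (mrestr g mD) g) => /=.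
have gDfin : g D \is a fin_num by exact: fin_num_measure.
have eT : mrestr g mD setT = g D by rewrite /mrestr setTI.
split => [C mC|gD0]; rewrite /mnormalize /= eT.
  have -> : (g D == +oo) = false by apply/negbTE; move: gDfin; rewrite fin_numE => /andP[].
  rewrite orbF; case: ifPn => [/eqP gD0|gD0].
    rewrite gD0 mul0e; apply/eqP; rewrite -measure_le0 -[leRHS]gD0.
    by apply: le_measure; rewrite ?inE//; exact: measurableI.
  rewrite muleCA /mrestr (_ : g D * _ = 1) ?mule1//.
  by rewrite -[X in X * _](fineK gDfin) -EFinM mulfV// -eqe fineK.
rewrite gt_eqF//= ifF; first by rewrite /mrestr setICl measure0 mul0e.
by apply/negbTE; move: gDfin; rewrite fin_numE => /andP[].
Qed.

End mixture.


Section gluing.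
Context (d1 d2 d3 : measure_display) (X : measurableType d1)
  (Y : measurableType d2) (Z : measurableType d3) (R : realType).

(* Conditionally on the cell of the partition containing the middle variable,
   the two pairs are made independent; this replaces disintegration. *)
Lemma gluing_along_partition (g1 : probability (X * Y)%type R)
    (g2 : probability (Y * Z)%type R) (Q : nat -> set Y) :
  (forall k, measurable (Q k)) -> trivIset setT Q -> \bigcup_k Q k = setT ->
  (forall B, measurable B -> g1 (setT `*` B) = g2 (B `*` setT)) ->
  exists M : probability ((X * Y) * (Y * Z))%type R,
    [/\ forall C, measurable C -> M (C `*` setT) = g1 C,
        forall C, measurable C -> M (setT `*` C) = g2 C &
        M (~` \bigcup_k ((setT `*` Q k) `*` (Q k `*` setT))) = 0].
Proof.
move=> mQ tQ QT g12.
have mXQ k : measurable ([set: X] `*` Q k) by exact: measurableX.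
have mQZ k : measurable (Q k `*` [set: Z]) by exact: measurableX.
have /choice[P /all_and2[P1 P2]] := fun k => conditioning_exists g1 (mXQ k).
have /choice[S /all_and2[S1 S2]] := fun k => conditioning_exists g2 (mQZ k).
have a0 k : (0 <= fine (g1 (setT `*` Q k)))%R by exact: fine_ge0.
pose a k : {nonneg R} := NngNum (a0 k).
have aE k : ((a k)%:num)%:E = g1 (setT `*` Q k) by rewrite /= fineK// fin_num_measure.
have g1E C : measurable C -> g1 C = \sum_(0 <= k <oo) ((a k)%:num)%:E * P k C.
  move=> mC; have {1}-> : C = \bigcup_k (C `&` (setT `*` Q k)).
    rewrite -setI_bigcupr (_ : \bigcup_k _ = setT) ?setIT//.
    apply/seteqP; split => // -[x y] _.
    by have : [set: Y] y by []; rewrite -QT => -[k _ Qy]; exists k.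
  rewrite measure_semi_bigcup//.
  - by apply: eq_eseriesr => k _; rewrite aE; exact: P1.
  - by move=> k; exact: measurableI.
  - apply/trivIsetP => i j _ _ ij; rewrite -subset0 => -[x y] [[_ [_ /= Qi]] [_ [_ /= Qj]]].
    by have /trivIsetP/(_ i j I I ij) := tQ; rewrite -subset0; apply; split; [exact: Qi|].
  - by apply: bigcup_measurable => k _; exact: measurableI.
have g2E C : measurable C -> g2 C = \sum_(0 <= k <oo) ((a k)%:num)%:E * S k C.
  move=> mC; have {1}-> : C = \bigcup_k (C `&` (Q k `*` setT)).
    rewrite -setI_bigcupr (_ : \bigcup_k _ = setT) ?setIT//.
    apply/seteqP; split => // -[y z] _.
    by have : [set: Y] y by []; rewrite -QT => -[k _ Qy]; exists k.
  rewrite measure_semi_bigcup//.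
  - by apply: eq_eseriesr => k _; rewrite aE g12//; exact: S1.
  - by move=> k; exact: measurableI.
  - apply/trivIsetP => i j _ _ ij; rewrite -subset0 => -[y z] [[_ [/= Qi _]] [_ [/= Qj _]]].
    by have /trivIsetP/(_ i j I I ij) := tQ; rewrite -subset0; apply; split; [exact: Qi|].
  - by apply: bigcup_measurable => k _; exact: measurableI.
have a1 : \sum_(0 <= k <oo) ((a k)%:num)%:E = 1.
  rewrite -(probability_setT g1) g1E//; apply: eq_eseriesr => k _.
  by rewrite probability_setT mule1.
have [M ME] := mixture_exists (fun k => (P k \x S k)%E : probability _ R) a1.
exists M; split => [C mC|C mC|].
- rewrite ME g1E//; apply: eq_eseriesr => k _ /=.
  by rewrite product_measure1E//= probability_setT mule1.
- rewrite ME g2E//; apply: eq_eseriesr => k _ /=.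
  by rewrite product_measure1E//= probability_setT mul1e.
- rewrite ME eseries0// => k _ _ /=; rewrite aE.
  have [->|gk0] := eqVneq (g1 (setT `*` Q k)) 0; first by rewrite mul0e.
  have gk : 0 < g1 (setT `*` Q k) by rewrite lt0e gk0 measure_ge0.
  apply/eqP; rewrite mule_eq0; apply/orP; right; rewrite -measure_le0.
  (* Outside the [k]-th block, the first pair leaves [Q k] or the second one does. Each event is
     null, since [P k] and [S k] are conditioned on that cell. *)
  set A := ~` ([set: X] `*` Q k); set B := ~` (Q k `*` [set: Z]).
  have mA : measurable A by exact: measurableC.
  have mB : measurable B by exact: measurableC.
  have -> : 0 = (P k \x S k) (A `*` setT) + (P k \x S k) (setT `*` B).
    by rewrite !product_measure1E//= [P k A]P2// [S k B]S2 -?g12// mul0e mule0 adde0.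
  apply: (le_trans _ (measureU2 _ _ _)) => /=; [|exact: measurableX..].
  apply: le_measure; rewrite ?inE.
  + apply/measurableC/bigcup_measurable => i _; exact: measurableX.
  + by apply: measurableU; exact: measurableX.
  + move=> [p q] /= npq; have [Ap|/contrapT nAp] := pselect (A p); first by left.
    by right; split => // Bq; apply: npq; exists k.
Qed.

End gluing.

(** * Borel structure of R^d *)

Section euclidean.
Context (R : realType) (d : nat).
Notation V := (Rd R d).

Lemma rV_dense_seq : exists q : nat -> 'rV[R]_d, forall (x : 'rV[R]_d) (e : R),
  (0 < e)%R -> exists k, forall i, (`|x ord0 i - q k ord0 i| < e)%R.
Proof.
pose q k : 'rV[R]_d :=
  if unpickle k is Some v then map_mx ratr (v : 'rV[rat]_d) else 0%R.
exists q => x e e0.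
have near_rat i : exists r : rat, (`|x ord0 i - ratr r| < e)%R.
  have [|r] := @rat_in_itvoo R (x ord0 i - e)%R (x ord0 i + e)%R; first by lra.
  by rewrite in_itv/= => /andP[? ?]; exists r; rewrite ltr_norml; lra.
have /choice[f fP] := near_rat.
exists (pickle (\row_i f i : 'rV[rat]_d)) => i.
by rewrite /q pickleK !mxE.
Qed.

Lemma measurable_coord i :
  measurable_fun setT (fun x : V => (x : 'rV[R]_d) ord0 i).
Proof.
apply: (measurability _ (RGenOpens.measurableE R)) => _ [_ [a [b ->]] <-].
rewrite setTI; apply: sub_sigma_algebra.
by apply: open_comp; [move=> x _; exact: coord_continuous|exact: itv_open].
Qed.

(** The sigma-algebra is generated by all open sets, whereas coordinates only control boxes. Second
    countability bridges the two: an open set is a countable union of boxes with centres in a dense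
    sequence and radii [1 / (n + 1)]. *)
Lemma measurable_fun_rV (disp : measure_display) (T : measurableType disp)
    (F : T -> V) :
  (forall i, measurable_fun setT (fun t => (F t : 'rV[R]_d) ord0 i)) ->
  measurable_fun setT F.
Proof.
move=> mF; apply: (@measurability _ _ T V setT F (@open 'rV[R]_d)) => [//|_ [U oU <-]].
rewrite setTI; have [q qP] := rV_dense_seq.
pose box (kn : nat * nat) := [set x : V | forall i,
  (`|(x : 'rV[R]_d) ord0 i - q kn.1 ord0 i| < kn.2.+1%:R^-1)%R].
have -> : F @^-1` U = \bigcup_kn
    (if pselect (box kn `<=` U) then F @^-1` box kn else set0).
  apply/seteqP; split => t /=; last by move=> [kn _]; case: pselect => // h /h.
  move=> Ut; have /nbhs_ballP[e /= e0 eU] := open_nbhs_nbhs (conj oU Ut).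
  (* A radius below [e / 2] keeps every box that contains [F t] inside the [e]-ball around it. *)
  have [n ne] := @ltr_add_invr R 0 (e / 2) ltac:(lra).
  have n0 : (0 < n.+1%:R^-1 :> R)%R by rewrite invr_gt0.
  have [k kP] := qP (F t) _ n0.
  exists (k, n) => //; case: pselect => // -[] y yB; apply: eU; split => // i j.
  rewrite (_ : i = ord0) -?ball_normE /=; last exact: ord1.
  have yBj : (`|(y : 'rV[R]_d) ord0 j - q k ord0 j| < n.+1%:R^-1)%R := yB j.
  have kPj : (`|(F t : 'rV[R]_d) ord0 j - q k ord0 j| < n.+1%:R^-1)%R := kP j.
  suff : (`|(F t : 'rV[R]_d) ord0 j - (y : 'rV[R]_d) ord0 j| < e)%R by [].
  move: ne yBj kPj; rewrite !ltr_norml; move: (n.+1%:R^-1)%R.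
  by move: ((F t : 'rV[R]_d) ord0 j) ((y : 'rV[R]_d) ord0 j) => *; lra.
apply: countable_bigcupT_measurable => [|kn]; first exact: countableP.
case: pselect => /= [?|?]; last exact: measurable0.
have -> : F @^-1` box kn = \bigcap_(i in [set: 'I_d])
   [set t | (`|(F t : 'rV[R]_d) ord0 i - q kn.1 ord0 i| < kn.2.+1%:R^-1)%R].
  by apply/seteqP; split => t h i; [move=> _|]; exact: h.
apply: fin_bigcap_measurable => [|i _]; first exact: finite_finset.
have -> : [set t | (`|(F t : 'rV[R]_d) ord0 i - q kn.1 ord0 i| < kn.2.+1%:R^-1)%R]
    = (fun t => (F t : 'rV[R]_d) ord0 i) @^-1` (ball (q kn.1 ord0 i) kn.2.+1%:R^-1).
  by apply/seteqP; split => t; rewrite /= -ball_normE /= distrC.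
by rewrite -[X in measurable X]setTI; apply: mF => //; exact: measurable_ball.
Qed.

Lemma measurable_interp a : measurable_fun setT (@interp R d a).
Proof.
apply: measurable_fun_rV => i.
under eq_fun do rewrite /interp mxE !mxE.
apply: measurable_funD; apply: measurable_funM => //.
- by apply: (measurableT_comp (measurable_coord i));
    exact: (measurableT_comp measurable_snd measurable_fst).
- by apply: (measurableT_comp (measurable_coord i)); exact: measurable_snd.
Qed.

Lemma measurable_sqdist (disp : measure_display) (T : measurableType disp)
    (f g : T -> V) :
  measurable_fun setT f -> measurable_fun setT g ->
  measurable_fun setT (fun t => (sqdist (f t : 'rV[R]_d) (g t : 'rV[R]_d))%:E).
Proof.
move=> mf mg; apply/measurable_EFinP/measurable_sum => i.
apply: measurable_funX; apply: measurable_funB.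
- exact: (measurableT_comp (measurable_coord i) mf).
- exact: (measurableT_comp (measurable_coord i) mg).
Qed.

Implicit Types x y z : 'rV[R]_d.

Lemma sqdist_ge0 x y : (0 <= sqdist x y)%R.
Proof. by apply: sumr_ge0 => i _; exact: sqr_ge0. Qed.

Lemma sqdistC x y : sqdist x y = sqdist y x.
Proof. by apply: eq_bigr => i _; rewrite -sqrrN opprB. Qed.

Lemma sqdistxx x : sqdist x x = 0%R.
Proof. by apply: big1 => i _; rewrite subrr expr0n. Qed.

Lemma sqdist_eq0 x y : sqdist x y = 0%R -> x = y.
Proof.
move=> /eqP; rewrite psumr_eq0 => [|i _]; last exact: sqr_ge0.
move=> /allP h; apply/rowP => i; apply/eqP; rewrite -subr_eq0 -sqrf_eq0.
by apply: h; rewrite mem_index_enum.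
Qed.

(** Young's inequality in each coordinate. Free of square roots, this form of the triangle
    inequality can be integrated term by term. *)
Lemma sqdist_triangle (e : R) x y z : (0 < e)%R ->
  (sqdist x z <= (1 + e) * sqdist x y + (1 + e^-1) * sqdist y z)%R.
Proof.
move=> e0; rewrite /sqdist !mulr_sumr -big_split/=; apply: ler_sum => i _.
set u := (x _ i - y _ i)%R; set v := (y _ i - z _ i)%R.
have -> : (x ord0 i - z ord0 i = u + v)%R by rewrite /u /v; ring.
have e1 : (e * e^-1 = 1)%R by rewrite mulfV// gt_eqF.
have : (0 <= e^-1 * (e * u - v) ^+ 2)%R.
  by rewrite mulr_ge0 ?sqr_ge0// invr_ge0 ltW.
have -> : (e^-1 * (e * u - v) ^+ 2 = (e * e^-1) * (e * u ^+ 2)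
    - 2 * (e * e^-1) * (u * v) + e^-1 * v ^+ 2)%R by ring.
rewrite e1; nra.
Qed.

(** The Hilbert-space identity behind convexity of the squared distance from the base along a
    generalized geodesic. *)
Lemma sqdist_interp (a : R) x y z :
  (sqdist x ((1 - a) *: y + a *: z) + a * (1 - a) * sqdist y z =
   (1 - a) * sqdist x y + a * sqdist x z)%R.
Proof.
rewrite /sqdist !mulr_sumr -!big_split/=; apply: eq_bigr => i _.
rewrite !mxE; ring.
Qed.

End euclidean.

(** * Couplings and transport plans *)

Section image_law.
Context (d1 d2 : measure_display) (T : measurableType d1)
  (U : measurableType d2) (R : realType).

Lemma image_law_exists (w : probability T R) (f : T -> U) :
  measurable_fun setT f ->
  exists v : probability U R, forall A, v A = w (f @^-1` A).
Proof.
move=> mf; pose mmf := isMeasurableFun.Build _ _ _ _ f mf.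
pose F : {mfun T >-> U} := HB.pack f mmf.
by exists (distribution w F).
Qed.

Lemma ge0_integral_image_law (w : probability T R) (v : probability U R)
    (f : T -> U) (h : U -> \bar R) :
  measurable_fun setT f -> (forall A, measurable A -> v A = w (f @^-1` A)) ->
  measurable_fun setT h -> (forall u, 0 <= h u) ->
  \int[v]_u h u = \int[w]_t h (f t).
Proof.
move=> mf vE mh h0; pose mmf := isMeasurableFun.Build _ _ _ _ f mf.
pose F : {mfun T >-> U} := HB.pack f mmf.
rewrite (eq_measure_integral (distribution w F)) => [|A mA _]; last exact: vE.
by rewrite ge0_integral_distribution.
Qed.

End image_law.

Section wasserstein.
Context (R : realType) (d : nat).
Notation V := (Rd R d).
Notation P := (probability V R).
Implicit Types mu nu om : P.

Lemma cost2_ge0 (g : probability (V * V)%type R) : 0 <= cost2 g.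
Proof. by apply: integral_ge0 => x _; rewrite lee_fin sqdist_ge0. Qed.

Lemma W2sq_ge0 mu nu : 0 <= W2sq mu nu.
Proof. by apply: le_ereal_inf_tmp => _ [g _ <-]; exact: cost2_ge0. Qed.

(** The joint law of [f] and [g] is an admissible coupling; the upper bounds on [W2sq] below come
    from this one. *)
Lemma W2sq_le_integral (disp : measure_display) (T : measurableType disp)
    (w : probability T R) (f g : T -> V) mu nu :
  measurable_fun setT f -> measurable_fun setT g ->
  (forall A, measurable A -> mu A = w (f @^-1` A)) ->
  (forall A, measurable A -> nu A = w (g @^-1` A)) ->
  W2sq mu nu <= \int[w]_t (sqdist (f t : 'rV[R]_d) (g t : 'rV[R]_d))%:E.
Proof.
move=> mf mg muE nuE.
have mfg := measurable_fun_pair mf mg.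
have [v vE] := image_law_exists w mfg.
apply: ereal_inf_lbound; exists v.
  split=> A mA; rewrite vE ?muE ?nuE//; congr (w _).
    by apply/seteqP; split => t //= [].
  by apply/seteqP; split => t //= [].
rewrite /cost2 (ge0_integral_image_law mfg (fun A _ => vE A)) => // [|x]; last first.
  by rewrite lee_fin sqdist_ge0.
by apply: measurable_sqdist; [exact: measurable_fst|exact: measurable_snd].
Qed.

Lemma W2sqxx mu : W2sq mu mu = 0.
Proof.
apply/eqP; rewrite eq_le W2sq_ge0 andbT.
have mid := @measurable_id _ V setT.
apply: (le_trans (@W2sq_le_integral _ _ mu idfun idfun _ _ mid mid _ _)) => //.
by rewrite integral0_eq// => x _; rewrite sqdistxx.
Qed.

Lemma W2sq_sym_le mu nu : W2sq nu mu <= W2sq mu nu.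
Proof.
apply: le_ereal_inf_tmp => _ [g [g1 g2] <-].
rewrite /cost2; under eq_integral do rewrite sqdistC.
apply: W2sq_le_integral => // A mA.
- by rewrite -g2//; congr (g _); apply/seteqP; split => t //= [].
- by rewrite -g1//; congr (g _); apply/seteqP; split => t //= [].
Qed.

Lemma W2sqC mu nu : W2sq mu nu = W2sq nu mu.
Proof. by apply/eqP; rewrite eq_le !W2sq_sym_le. Qed.

Lemma P2E om mu : P2 om mu <-> W2sq mu om < +oo.
Proof.
rewrite /P2 /W2; have := W2sq_ge0 mu om.
by case: (W2sq mu om) => [r _|//|//]; rewrite !ltry.
Qed.

(** Unit boxes around a dense sequence, made disjoint by [seqDU]. Two points of a cell differ by
    less than 2 in each coordinate, whence [4] per coordinate. *)
Lemma countable_partition_bounded_cells : exists Q : nat -> set V,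
  [/\ forall k, measurable (Q k), trivIset setT Q, \bigcup_k Q k = setT &
      forall k (y z : 'rV[R]_d), Q k y -> Q k z -> (sqdist y z <= d%:R * 4)%R].
Proof.
have [q qP] := rV_dense_seq R d.
pose B k := [set x : V | forall i, (`|(x : 'rV[R]_d) ord0 i - q k ord0 i| < 1)%R].
exists (seqDU B); split.
- apply: seqDU_measurable => k.
  have -> : B k = \bigcap_(i in [set: 'I_d])
      (fun x : V => (x : 'rV[R]_d) ord0 i) @^-1` (ball (q k ord0 i) 1%R).
    apply/seteqP; split => x h i; first by move=> _; rewrite /= -ball_normE/= distrC; exact: h.
    by have := h i I; rewrite /= -ball_normE/= distrC.
  apply: fin_bigcap_measurable => [|i _]; first exact: finite_finset.
  by rewrite -[X in measurable X]setTI; apply: measurable_coord => //; exact: measurable_ball.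
- exact: trivIset_seqDU.
- rewrite -seqDU_bigcup_eq; apply/seteqP; split => // x _.
  by have [k kP] := qP x 1%R ltr01; exists k.
- move=> k y z [By _] [Bz _]; rewrite /sqdist.
  apply: (@le_trans _ _ (\sum_(i < d) 4)%R); last first.
    by rewrite sumr_const card_ord mulr_natl.
  apply: ler_sum => i _; have yi : (`|y ord0 i - q k ord0 i| < 1)%R := By i.
  have zi : (`|z ord0 i - q k ord0 i| < 1)%R := Bz i.
  move: yi zi; rewrite !ltr_norml; move: (y ord0 i) (z ord0 i) (q k ord0 i) => a b c.
  nra.
Qed.

(** In the glued measure the two copies [y], [y'] of the middle variable need not agree, but almost
    surely they share a cell. Their bounded distance costs only an additive constant, which is
    harmless for finiteness. *)
Lemma W2sq_lty_trans mu om nu :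
  W2sq mu om < +oo -> W2sq om nu < +oo -> W2sq mu nu < +oo.
Proof.
move=> /ereal_inf_lt[_ [g1 [g1l g1r] <-] c1] /ereal_inf_lt[_ [g2 [g2l g2r] <-] c2].
have [Q [mQ tQ QT Qd]] := countable_partition_bounded_cells.
have [|M [Ml Mr M0]] := @gluing_along_partition _ _ _ V V V R g1 g2 Q mQ tQ QT.
  by move=> B mB; rewrite g1r// g2l.
have mx : measurable_fun setT (fun p : (V * V) * (V * V) => p.1.1).
  exact: (measurableT_comp measurable_fst measurable_fst).
have my : measurable_fun setT (fun p : (V * V) * (V * V) => p.1.2).
  exact: (measurableT_comp measurable_snd measurable_fst).
have my' : measurable_fun setT (fun p : (V * V) * (V * V) => p.2.1).
  exact: (measurableT_comp measurable_fst measurable_snd).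
have mz : measurable_fun setT (fun p : (V * V) * (V * V) => p.2.2).
  exact: (measurableT_comp measurable_snd measurable_snd).
apply: (le_lt_trans (@W2sq_le_integral _ _ M _ _ mu nu mx mz _ _)).
- move=> A mA; rewrite -g1l// -Ml; last exact: measurableX.
  by congr (M _); apply/seteqP; split => -[[? ?] [? ?]] //= [[]].
- move=> A mA; rewrite -g2r// -Mr; last exact: measurableX.
  by congr (M _); apply/seteqP; split => -[[? ?] [? ?]] //= [_ []].
pose f1 (p : (V * V) * (V * V)) := (sqdist (p.1.1 : 'rV[R]_d) (p.1.2 : 'rV[R]_d))%:E.
pose f2 (p : (V * V) * (V * V)) := (sqdist (p.2.1 : 'rV[R]_d) (p.2.2 : 'rV[R]_d))%:E.
have mf1 : measurable_fun setT f1 by exact: measurable_sqdist.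
have mf2 : measurable_fun setT f2 by exact: measurable_sqdist.
have f10 p : 0 <= f1 p by rewrite lee_fin sqdist_ge0.
have f20 p : 0 <= f2 p by rewrite lee_fin sqdist_ge0.
have mc : measurable_fun setT (fun p : V * V => (sqdist (p.1 : 'rV[R]_d) (p.2 : 'rV[R]_d))%:E).
  by apply: measurable_sqdist; [exact: measurable_fst|exact: measurable_snd].
have if1 : \int[M]_p f1 p = cost2 g1.
  rewrite /cost2 (ge0_integral_image_law (w := M) measurable_fst)// => [A mA|x].
    by rewrite -Ml//; congr (M _); apply/seteqP; split => p //= [].
  by rewrite lee_fin sqdist_ge0.
have if2 : \int[M]_p f2 p = cost2 g2.
  rewrite /cost2 (ge0_integral_image_law (w := M) measurable_snd)// => [A mA|x].
    by rewrite -Mr//; congr (M _); apply/seteqP; split => p //= [].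
  by rewrite lee_fin sqdist_ge0.
have c0 : (0 <= d%:R * 16 :> R)%R by rewrite mulr_ge0.
(* Two applications of [sqdist_triangle] with parameter 1 give the factors 2 and 2 * 2; the cell
   bound [d * 4] is multiplied by 4 as well. *)
apply: (@le_lt_trans _ _ (\int[M]_p (2%:E * f1 p + (4%:E * f2 p + cst (d%:R * 16)%:E p)))).
  apply: ae_ge0_le_integral => //.
  - by move=> p _; rewrite lee_fin sqdist_ge0.
  - exact: measurable_sqdist.
  - by move=> p _; rewrite !adde_ge0// ?mule_ge0.
  - apply: emeasurable_funD; first exact: measurable_funeM.
    by apply: emeasurable_funD => //; exact: measurable_funeM.
  - exists (~` \bigcup_k (([set: V] `*` Q k) `*` (Q k `*` [set: V]))); split => //.
      apply/measurableC/bigcup_measurable => k _.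
      by apply: measurableX; exact: measurableX.
    apply: subsetC => -[[x y] [y' z]] /= [k _ [[_ /= Qy] [/= Qy' _]]] _.
    rewrite /f1 /f2 /= -!EFinM -!EFinD lee_fin.
    have h1 := @sqdist_triangle R d 1 x y z ltr01.
    have h2 := @sqdist_triangle R d 1 y y' z ltr01.
    have h3 := Qd _ _ _ Qy Qy'.
    move: h1 h2 h3; rewrite invr1.
    by move: (sqdist x z) (sqdist x y) (sqdist y z) (sqdist y y') (sqdist y' z) => *; lra.
rewrite ge0_integralD//; last 4 first.
- by move=> p _; rewrite mule_ge0.
- exact: measurable_funeM.
- by move=> p _; rewrite adde_ge0// mule_ge0.
- by apply: emeasurable_funD => //; exact: measurable_funeM.
rewrite ge0_integralD//; last 2 first.
- by move=> p _; rewrite mule_ge0.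
- exact: measurable_funeM.
rewrite !ge0_integralZl// if1 if2 integral_cst//.
rewrite !lte_add_pinfty//; apply: lte_mul_pinfty; rewrite ?cost2_ge0// ?lee_fin//.
exact: le_lt_trans (@probability_le1 _ _ _ M setT measurableT) (ltry _).
Qed.

(** * Integral estimates for a transport plan *)

Section plan.
Context (om mu0 mu1 : P) (w : probability (V * V * V)%type R).
Hypothesis plan_w : is_plan om mu0 mu1 w.

Let m1 : measurable_fun setT (fun p : V * V * V => p.1.1).
Proof. exact: (measurableT_comp measurable_fst measurable_fst). Qed.
Let m2 : measurable_fun setT (fun p : V * V * V => p.1.2).
Proof. exact: (measurableT_comp measurable_snd measurable_fst). Qed.
Let m3 : measurable_fun setT (fun p : V * V * V => p.2).
Proof. exact: measurable_snd. Qed.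
Let mc : measurable_fun setT
  (fun p : V * V => (sqdist (p.1 : 'rV[R]_d) (p.2 : 'rV[R]_d))%:E).
Proof. by apply: measurable_sqdist; [exact: measurable_fst|exact: measurable_snd]. Qed.

Let law1 A : measurable A -> om A = w ((fun p => p.1.1) @^-1` A).
Proof.
have [[[h _] _] _] := plan_w; move=> mA; rewrite -h// /pushforward.
by congr (w _); apply/seteqP; split => p //= [].
Qed.
Let law2 A : measurable A -> mu0 A = w ((fun p => p.1.2) @^-1` A).
Proof.
have [[[_ h] _] _] := plan_w; move=> mA; rewrite -h// /pushforward.
by congr (w _); apply/seteqP; split => p //= [].
Qed.
Let law3 A : measurable A -> mu1 A = w ((fun p => p.2) @^-1` A).
Proof.
have [_ [[_ h] _]] := plan_w; move=> mA; rewrite -h// /pushforward.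
by congr (w _); apply/seteqP; split => p //= [].
Qed.

Lemma plan_cost12 :
  \int[w]_p (sqdist (p.1.1 : 'rV[R]_d) (p.1.2 : 'rV[R]_d))%:E = W2sq om mu0.
Proof.
have [[_ <-] _] := plan_w; rewrite /cost2 ge0_integral_pushforward//.
- exact: measurable_fun_pair.
- by move=> p _; rewrite lee_fin sqdist_ge0.
Qed.

Lemma plan_cost13 :
  \int[w]_p (sqdist (p.1.1 : 'rV[R]_d) (p.2 : 'rV[R]_d))%:E = W2sq om mu1.
Proof.
have [_ [_ <-]] := plan_w; rewrite /cost2 ge0_integral_pushforward//.
- exact: measurable_fun_pair.
- by move=> p _; rewrite lee_fin sqdist_ge0.
Qed.

Lemma W2sq_le_W2plan : W2sq mu0 mu1 <= W2plan_sq w.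
Proof. exact: W2sq_le_integral. Qed.

(** The Young form of the triangle inequality through the base point, integrated; optimizing over
    [e] later yields the inequality between square roots. *)
Lemma W2plan_triangle (e : R) : (0 < e)%R ->
  W2plan_sq w <= (1 + e)%:E * W2sq om mu0 + (1 + e^-1)%:E * W2sq om mu1.
Proof.
move=> e0; rewrite -plan_cost12 -plan_cost13.
have e1 : (0 <= 1 + e)%R by lra.
have e2 : (0 <= 1 + e^-1)%R by rewrite addr_ge0// invr_ge0 ltW.
have s12 := measurable_sqdist m1 m2; have s13 := measurable_sqdist m1 m3.
have p0 (x y : 'rV[R]_d) : 0 <= (sqdist x y)%:E by rewrite lee_fin sqdist_ge0.
rewrite -!ge0_integralZl// -ge0_integralD//; last 4 first.
- by move=> p _; rewrite mule_ge0.
- exact: measurable_funeM.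
- by move=> p _; rewrite mule_ge0.
- exact: measurable_funeM.
apply: ge0_le_integral => //.
- exact: measurable_sqdist.
- by apply: emeasurable_funD; exact: measurable_funeM.
- move=> p _; rewrite -!EFinM -EFinD lee_fin.
  by rewrite [sqdist p.1.1 p.1.2]sqdistC; exact: sqdist_triangle.
Qed.

Lemma interp_law_exists (a : R) :
  exists mua : P, forall A, mua A = pushforward w (interp a) A.
Proof. exact: image_law_exists (measurable_interp a). Qed.

(** The only loss is bounding [W2sq om mua] by the cost of the coupling of the base point with the
    interpolant; the rest is [sqdist_interp] integrated. *)
Lemma W2sq_interp (a : R) (mua : P) : (0 <= a <= 1)%R ->
  (forall A, measurable A -> mua A = pushforward w (interp a) A) ->
  W2sq om mua + (a * (1 - a))%:E * W2plan_sq w <=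
    (1 - a)%:E * W2sq om mu0 + a%:E * W2sq om mu1.
Proof.
move=> /andP[a0 a1] muaE; rewrite -plan_cost12 -plan_cost13.
have b0 : (0 <= 1 - a)%R by rewrite subr_ge0.
have s12 := measurable_sqdist m1 m2; have s13 := measurable_sqdist m1 m3.
have s23 := measurable_sqdist m2 m3.
have s1a := measurable_sqdist m1 (measurable_interp a).
have p0 (x y : 'rV[R]_d) : 0 <= (sqdist x y)%:E by rewrite lee_fin sqdist_ge0.
have ab0 : (0 <= a * (1 - a))%R by exact: mulr_ge0.
rewrite -!ge0_integralZl// -ge0_integralD//; last 4 first.
- by move=> p _; rewrite mule_ge0.
- exact: measurable_funeM.
- by move=> p _; rewrite mule_ge0.
- exact: measurable_funeM.
apply: (@le_trans _ _ (\int[w]_p ((sqdist (p.1.1 : 'rV[R]_d) (interp a p : 'rV[R]_d))%:E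
   + (a * (1 - a))%:E * (sqdist (p.1.2 : 'rV[R]_d) (p.2 : 'rV[R]_d))%:E))).
  rewrite ge0_integralD//; last 2 first.
  - by move=> p _; rewrite mule_ge0.
  - exact: measurable_funeM.
  by rewrite leeD//; apply: W2sq_le_integral => //; exact: measurable_interp.
rewrite le_eqVlt; apply/orP; left; apply/eqP; apply: eq_integral => p _.
by rewrite -!EFinM -!EFinD; congr (_%:E); exact: sqdist_interp.
Qed.

End plan.
End wasserstein.

(** * The double recursion *)

Local Close Scope ereal_scope.

Section real_estimates.
Context (R : realType).
Implicit Types (a b c e k h tau S : R).

Lemma sqrt_le_of_young a b c : 0 <= a -> 0 <= b ->
  (forall e, 0 < e -> c <= (1 + e) * a + (1 + e^-1) * b) ->
  Num.sqrt c <= Num.sqrt a + Num.sqrt b.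
Proof.
move=> a0 b0 young; apply/ler_addgt0Pr => e e0.
have u0 := sqrtr_ge0 a; have v0 := sqrtr_ge0 b.
have ua := sqr_sqrtr a0; have vb := sqr_sqrtr b0.
set u := Num.sqrt a in u0 ua *; set v := Num.sqrt b in v0 vb *.
(* The optimal parameter is [v / u], which turns the right-hand side into a perfect square. Both
   roots are shifted by [e / 2] because either may vanish. *)
have u'0 : 0 < u + e / 2 by lra.
have v'0 : 0 < v + e / 2 by lra.
have := young _ (divr_gt0 v'0 u'0); rewrite invf_div => cle.
rewrite -[leRHS]gtr0_norm; last by lra.
rewrite -sqrtr_sqr; apply: ler_wsqrtr; apply: (le_trans cle).
set u' := u + e / 2 in u'0 *; set v' := v + e / 2 in v'0 *.
have au : a <= u' ^+ 2 by rewrite -ua /u'; nra.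
have bv : b <= v' ^+ 2 by rewrite -vb /v'; nra.
have -> : u + v + e = u' + v' by rewrite /u' /v'; lra.
have c1 : 0 <= 1 + v' / u' by rewrite addr_ge0// divr_ge0// ltW.
have c2 : 0 <= 1 + u' / v' by rewrite addr_ge0// divr_ge0// ltW.
apply: (le_trans (lerD (ler_wpM2l c1 au) (ler_wpM2l c2 bv))).
rewrite le_eqVlt; apply/orP; left; apply/eqP.
by field; rewrite !gt_eqF.
Qed.

(** Chosen because for [k = 0] it satisfies the recursion of [double_sequence_bound] with
    equality. *)
Definition crandall_liggett_weight tau h (n m : nat) : R :=
  (n%:R * tau - m%:R * h) ^+ 2 + n%:R * tau ^+ 2 + m%:R * h ^+ 2.

(** Comparison with a supersolution, by induction on [n] and, inside it, on [m]. *)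
Lemma double_sequence_bound k tau h (S2 : R) (D : nat -> nat -> R) :
  0 < h -> h <= tau -> 0 <= k -> k * tau < 1 -> 0 <= S2 ->
  (forall n m, (tau + h - 2 * k * h * tau) * D n.+1 m.+1 <=
     tau * D n.+1 m + h * D n m.+1) ->
  (forall n, D n 0%N <=
     crandall_liggett_weight tau h n 0 * (1 - k * tau) ^- (2 * n) * S2) ->
  (forall m, D 0%N m <=
     crandall_liggett_weight tau h 0 m * (1 - k * h) ^- (2 * m) * S2) ->
  forall n m, D n m <= crandall_liggett_weight tau h n m
     * (1 - k * tau) ^- (2 * n) * (1 - k * h) ^- (2 * m) * S2.
Proof.
move=> h0 htau k0 ktau S20 Drec Dn0 D0m.
have kh : k * h < 1 by apply: le_lt_trans ktau; exact: ler_wpM2l.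
elim=> [|n IHn] m.
  by apply: (le_trans (D0m m)); rewrite muln0 expr0 invr1 mulr1.
elim: m => [|m IHm].
  by apply: (le_trans (Dn0 n.+1)); rewrite muln0 expr0 invr1 mulr1.
have {}IHn := IHn m.+1.
set A := (1 - k * tau) ^- (2 * n.+1); set B := (1 - k * h) ^- (2 * m.+1).
have q0 : 0 < 1 - k * tau by lra.
have p0 : 0 < 1 - k * h by lra.
have AE : (1 - k * tau) ^- (2 * n) = (1 - k * tau) ^+ 2 * A.
  by rewrite /A mulnS exprD invfM mulrA mulfV ?mul1r// expf_neq0// gt_eqF.
have BE : (1 - k * h) ^- (2 * m) = (1 - k * h) ^+ 2 * B.
  by rewrite /B mulnS exprD invfM mulrA mulfV ?mul1r// expf_neq0// gt_eqF.
have A0 : 0 <= A by rewrite invr_ge0 exprn_ge0// ltW.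
have B0 : 0 <= B by rewrite invr_ge0 exprn_ge0// ltW.
(* The coefficient equals [tau * (1 - k * h) + h * (1 - k * tau)]. *)
have c0 : 0 < tau + h - 2 * k * h * tau by nra.
rewrite -(ler_pM2l c0); apply: (le_trans (Drec n m)).
have tau0 : 0 < tau by lra.
have ltau := ler_wpM2l (ltW tau0) IHm.
have lh := ler_wpM2l (ltW h0) IHn.
apply: (le_trans (lerD ltau lh)); rewrite AE BE.
pose G := A * B * S2.
have G0 : 0 <= G by rewrite !mulr_ge0.
set F := crandall_liggett_weight tau h n.+1 m.+1.
pose dl := n.+1%:R * tau - m.+1%:R * h.
have F1 : crandall_liggett_weight tau h n.+1 m = F + 2 * dl * h.
  by rewrite /F /dl /crandall_liggett_weight -(natr1 m); ring.
have F2 : crandall_liggett_weight tau h n m.+1 = F - 2 * dl * tau.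
  by rewrite /F /dl /crandall_liggett_weight -(natr1 n); ring.
rewrite F1 F2 -subr_ge0.
(* The terms without [k] cancel, and the remaining defect factors into a product whose signs can be
   read off. *)
have -> : (tau + h - 2 * k * h * tau) * (F * A * B * S2) -
    (tau * ((F + 2 * dl * h) * A * ((1 - k * h) ^+ 2 * B) * S2) +
     h * ((F - 2 * dl * tau) * ((1 - k * tau) ^+ 2 * A) * B * S2)) =
   k * h * tau * ((2 - k * (h + tau)) * (F + 2 * dl * (h - tau))) * G.
  by rewrite /G; ring.
rewrite mulr_ge0// mulr_ge0//; first by rewrite !mulr_ge0// ltW.
apply: mulr_ge0; first by rewrite mulrDr; lra.
(* Completing the square costs [(h - tau) ^+ 2]; one of the [n.+1] copies of [tau ^+ 2] in [F] pays
   for it and leaves [h * (2 * tau - h)]. *)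
have -> : F + 2 * dl * (h - tau) = (dl + (h - tau)) ^+ 2 + h * (2 * tau - h)
    + n%:R * tau ^+ 2 + m.+1%:R * h ^+ 2.
  by rewrite /F /crandall_liggett_weight -/dl -[n.+1%:R]natr1; ring.
have t2h : 0 <= h * (2 * tau - h) by apply: mulr_ge0; lra.
by rewrite !addr_ge0 ?sqr_ge0// mulr_ge0 ?sqr_ge0.
Qed.

Lemma weight_le tau h (n m : nat) : 0 < h -> h <= tau ->
  crandall_liggett_weight tau h n m <=
  (n%:R * tau - m%:R * h) ^+ 2 + tau * h * m%:R + 2 * tau ^+ 2 * n%:R.
Proof.
move=> h0 htau; rewrite /crandall_liggett_weight.
have n0 : 0 <= n%:R * tau ^+ 2 by rewrite mulr_ge0 ?sqr_ge0.
have : 0 <= m%:R * (h * (tau - h)).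
  by apply: mulr_ge0 => //; apply: mulr_ge0; lra.
move: n0; rewrite [h * (_ - _)]mulrBr [m%:R * (_ - _)]mulrBr.
have -> : tau * h * m%:R = m%:R * (h * tau) by ring.
have -> : 2 * tau ^+ 2 * n%:R = 2 * (n%:R * tau ^+ 2) by ring.
have -> : m%:R * h ^+ 2 = m%:R * (h * h) by ring.
lra.
Qed.

(** * Discrete evolution variational inequalities for an abstract squared distance *)

Section metric.
Context (T : Type) (dom : T -> Prop) (D : T -> T -> R) (Er : T -> R) (k : R).
Hypothesis D_ge0 : forall x y, 0 <= D x y.
Hypothesis DC : forall x y, D x y = D y x.
Hypothesis Dxx : forall x, D x x = 0.
Hypothesis D_triangle : forall x y z, dom x -> dom y -> dom z ->
  Num.sqrt (D x z) <= Num.sqrt (D x y) + Num.sqrt (D y z).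
Hypothesis k_ge0 : 0 <= k.

Definition evi_step tau x y := forall v, dom v ->
  (1 - k * tau) * D y v <= D x v - D x y + 2 * tau * (Er v - Er y).

(** Test the first step at [z] and the second at [y]: the energies cancel in the sum. Bounding the
    distance from [x] to [z] by the triangle inequality leaves a common factor, the length of the
    second step. *)
Lemma evi_step_contract tau x y z : dom x -> dom y -> dom z ->
  k * tau < 1 -> evi_step tau x y -> evi_step tau y z ->
  Num.sqrt (D y z) <= (1 - k * tau)^-1 * Num.sqrt (D x y).
Proof.
move=> dx dy dz ktau /(_ z dz) e1 /(_ y dy) e2.
have tri := D_triangle dx dy dz.
rewrite mulrC ler_pdivlMr; last by lra.
rewrite Dxx (DC z y) in e2.
have a0 := sqrtr_ge0 (D x y); have b0 := sqrtr_ge0 (D y z).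
have c0 := sqrtr_ge0 (D x z).
have := sqr_sqrtr (D_ge0 x y); have := sqr_sqrtr (D_ge0 y z).
have := sqr_sqrtr (D_ge0 x z).
move: tri a0 b0 c0; set a := Num.sqrt (D x y); set b := Num.sqrt (D y z).
set c := Num.sqrt (D x z) => tri a0 b0 c0 cE bE aE.
have c2 : c ^+ 2 <= (a + b) ^+ 2 by rewrite ler_sqr// nnegrE addr_ge0.
have key : b * ((1 - k * tau) * b) <= b * a.
  by move: e1 e2 c2; rewrite -aE -bE -cE; move: (k * tau) (tau) => u t; nra.
have [b00|bn0] := eqVneq b 0; first by rewrite b00 mul0r.
have bpos : 0 < b by rewrite lt0r bn0.
by rewrite (ler_pM2l bpos) in key; rewrite mulrC.
Qed.

Variables (mu : T) (S : R).
Hypothesis dom_mu : dom mu.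
Hypothesis S_ge0 : 0 <= S.
Hypothesis slope_mu : forall v, dom v ->
  Er mu - Er v <= S * Num.sqrt (D mu v) + k / 2 * D mu v.

(** Test the step at its starting point [mu], and bound the energy drop by the global slope
    inequality. *)
Lemma evi_first_step tau y : dom y -> 0 < tau -> k * tau < 1 ->
  evi_step tau mu y -> Num.sqrt (D mu y) <= (1 - k * tau)^-1 * (tau * S).
Proof.
move=> dy tau0 ktau /(_ mu dom_mu); rewrite Dxx (DC y mu).
have := slope_mu dy; have := sqr_sqrtr (D_ge0 mu y); have := sqrtr_ge0 (D mu y).
set b := Num.sqrt _ => b0 bE sl e1.
rewrite mulrC ler_pdivlMr; last by lra.
rewrite -bE in sl e1.
have sl2 := ler_wpM2l (ltW tau0) sl.
have key : b * ((1 - k * tau) * b) <= b * (tau * S).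
  have -> : b * ((1 - k * tau) * b) = b ^+ 2 - tau * (k * b ^+ 2) by ring.
  move: sl2 e1.
  have -> : tau * (S * b + k / 2 * b ^+ 2) = b * (tau * S) + tau * (k * b ^+ 2) / 2 by field.
  have -> : (1 - k * tau) * b ^+ 2 = b ^+ 2 - tau * (k * b ^+ 2) by ring.
  rewrite mulrBr; lra.
have [->|bn0] := eqVneq b 0; first by rewrite mul0r mulr_ge0// ltW.
have bpos : 0 < b by rewrite lt0r bn0.
by rewrite (ler_pM2l bpos) in key; rewrite mulrC.
Qed.

(** Step lengths grow at most geometrically with ratio [r >= 1], so the path length up to [n] is at
    most [n] times the largest bound [r ^+ n * (tau * S)]. *)
Lemma evi_displacement tau (s : nat -> T) : 0 < tau -> k * tau < 1 ->
  s 0%N = mu -> (forall n, dom (s n)) -> (forall n, evi_step tau (s n) (s n.+1)) ->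
  forall n, D (s n) mu <=
    (n%:R * tau) ^+ 2 * (1 - k * tau) ^- (2 * n) * (S * S).
Proof.
move=> tau0 ktau s0 ds evi n.
have q0 : 0 < 1 - k * tau by lra.
pose r := (1 - k * tau)^-1.
have r1 : 1 <= r by rewrite invf_ge1//; have := mulr_ge0 k_ge0 (ltW tau0); lra.
have r0 : 0 <= r by lra.
have step i : Num.sqrt (D (s i) (s i.+1)) <= r ^+ i.+1 * (tau * S).
  elim: i => [|i IH]; first by rewrite expr1 s0; apply: evi_first_step => //; rewrite -s0.
  apply: (le_trans (evi_step_contract (ds _) (ds _) (ds _) ktau (evi i) (evi i.+1))).
  by rewrite exprS -mulrA ler_wpM2l.
have dist : Num.sqrt (D mu (s n)) <= n%:R * (r ^+ n * (tau * S)).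
  elim: n => [|n IH]; first by rewrite s0 Dxx sqrtr0 mul0r.
  apply: (le_trans (D_triangle dom_mu (ds n) (ds n.+1))).
  rewrite -natr1 mulrDl mul1r; apply: lerD (step n).
  apply: (le_trans IH); apply: ler_wpM2l => //; apply: ler_wpM2r.
    by rewrite mulr_ge0// ltW.
  by rewrite exprS ler_peMl// exprn_ge0.
rewrite DC -(sqr_sqrtr (D_ge0 mu (s n))).
have -> : (n%:R * tau) ^+ 2 * (1 - k * tau) ^- (2 * n) * (S * S) =
    (n%:R * (r ^+ n * (tau * S))) ^+ 2.
  by rewrite mulnC exprM -exprVn -[in LHS]exprVn -/r; ring.
by rewrite ler_sqr ?nnegrE ?sqrtr_ge0// !mulr_ge0 ?exprn_ge0// ltW.
Qed.

Lemma evi_two_step_estimate tau h (s t : nat -> T) :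
  0 < h -> h <= tau -> k * tau < 1 ->
  s 0%N = mu -> (forall n, dom (s n)) -> (forall n, evi_step tau (s n) (s n.+1)) ->
  t 0%N = mu -> (forall n, dom (t n)) -> (forall n, evi_step h (t n) (t n.+1)) ->
  forall n m, D (s n) (t m) <=
    ((n%:R * tau - m%:R * h) ^+ 2 + tau * h * m%:R + 2 * tau ^+ 2 * n%:R)
    * (1 - k * tau) ^- (2 * n) * (1 - k * h) ^- (2 * m) * (S * S).
Proof.
move=> h0 htau ktau s0 ds es t0 dt et n m.
have tau0 : 0 < tau by lra.
have kh : k * h < 1 by apply: le_lt_trans ktau; exact: ler_wpM2l.
have q0 : 0 < 1 - k * tau by lra.
have p0 : 0 < 1 - k * h by lra.
have iq i : 0 <= (1 - k * tau) ^- i by rewrite invr_ge0 exprn_ge0// ltW.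
have ip i : 0 <= (1 - k * h) ^- i by rewrite invr_ge0 exprn_ge0// ltW.
have SS : 0 <= S * S by rewrite mulr_ge0.
apply: (le_trans (@double_sequence_bound k tau h (S * S)
    (fun n m => D (s n) (t m)) h0 htau k_ge0 ktau SS _ _ _ n m)).
- move=> i j.
  have e1 := ler_wpM2l (ltW h0) (es i _ (dt j.+1)).
  have e2 := ler_wpM2l (ltW tau0) (et j _ (ds i.+1)).
  rewrite (DC (t j.+1)) (DC (t j) (s i.+1)) in e2.
  (* The squared step lengths enter with a favourable sign and are dropped. *)
  have d1 := mulr_ge0 (ltW h0) (D_ge0 (s i) (s i.+1)).
  have d2 := mulr_ge0 (ltW tau0) (D_ge0 (t j) (t j.+1)).
  rewrite -subr_ge0; rewrite -subr_ge0 in e1; rewrite -subr_ge0 in e2.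
  have := addr_ge0 (addr_ge0 e1 e2) (addr_ge0 d1 d2).
  by congr (_ <= _); ring.
- move=> i; rewrite t0; apply: (le_trans (evi_displacement tau0 ktau s0 ds es i)).
  apply: ler_wpM2r => //; apply: ler_wpM2r => //.
  rewrite /crandall_liggett_weight mul0r subr0 mul0r addr0 lerDl.
  by rewrite mulr_ge0 ?sqr_ge0.
- move=> j; rewrite s0 DC; apply: (le_trans (evi_displacement h0 kh t0 dt et j)).
  apply: ler_wpM2r => //; apply: ler_wpM2r => //.
  rewrite /crandall_liggett_weight !mul0r sub0r sqrrN addr0 lerDl.
  by rewrite mulr_ge0 ?sqr_ge0.
- by do 3![apply: ler_wpM2r => //]; exact: weight_le.
Qed.

End metric.
End real_estimates.

Local Open Scope ereal_scope.

(** * The proximal scheme *)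

(** Used to let the geodesic parameter [a] tend to 0 in inequalities already divided by [a]. *)
Lemma le_of_small_perturbation (R : realType) (X Y Z a0 : R) : (0 < a0)%R ->
  (forall a : R, (0 < a < a0)%R -> (X - a * Y <= Z)%R) -> (X <= Z)%R.
Proof.
move=> a00 H; apply/ler_addgt0Pr => e e0.
have Y1 : (0 < `|Y| + 1)%R by rewrite ltr_wpDl.
have b0 : (0 < e / (`|Y| + 1))%R by exact: divr_gt0.
pose a := Num.min (a0 / 2)%R (e / (`|Y| + 1))%R.
have a_gt0 : (0 < a)%R by rewrite lt_min b0 andbT; lra.
have aY : (a * Y <= e)%R.
  apply: (@le_trans _ _ (a * (`|Y| + 1))%R).
    by rewrite ler_pM2l// ler_wpDr// ler_norm.
  by rewrite -ler_pdivlMr// ge_min lexx orbT.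
have aa0 : (a < a0)%R.
  have : (a <= a0 / 2)%R by rewrite ge_min lexx.
  lra.
by have := H a; rewrite a_gt0 aa0 => /(_ isT); lra.
Qed.

Section functional.
Context (R : realType) (d : nat).
Notation V := (Rd R d).
Notation P := (probability V R).
Variables (om0 : P) (E : P -> \bar R) (lam : R).
Hypothesis E_notNy : values_in_Rpinfty om0 E.
Hypothesis E_lsc : W2_lsc om0 E.
Hypothesis E_convex : convex_gen_geod om0 lam E.

(** Real-valued versions for the abstract recursion. Since [fine] sends infinite values to 0, they
    are faithful only under the conditions of [W2sqE] and [energyE]. *)
Local Definition W2sqr (x y : P) : R := fine (W2sq x y).
Local Definition energyr (x : P) : R := fine (E x).
Local Definition finite_energy (x : P) : Prop := P2 om0 x /\ E x < +oo.

Lemma W2sqr_ge0 x y : (0 <= W2sqr x y)%R.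
Proof. by apply: fine_ge0; exact: W2sq_ge0. Qed.

Lemma W2sq_fin x y : W2sq x y < +oo -> W2sq x y = (W2sqr x y)%:E.
Proof. by move=> h; rewrite fineK// ge0_fin_numE// W2sq_ge0. Qed.

Lemma W2sqE x y : P2 om0 x -> P2 om0 y -> W2sq x y = (W2sqr x y)%:E.
Proof.
move=> /P2E hx /P2E hy; apply: W2sq_fin; apply: (W2sq_lty_trans hx).
by rewrite W2sqC.
Qed.

Lemma W2E x y : P2 om0 x -> P2 om0 y -> W2 x y = (Num.sqrt (W2sqr x y))%:E.
Proof. by move=> hx hy; rewrite /W2 W2sqE. Qed.

Lemma P2_near x y : P2 om0 x -> W2sq x y < +oo -> P2 om0 y.
Proof.
move=> /P2E hx hy; apply/P2E; apply: W2sq_lty_trans hx.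
by rewrite W2sqC.
Qed.

Lemma energyE x : finite_energy x -> E x = (energyr x)%:E.
Proof.
move=> [hx Ex]; have := E_notNy hx; rewrite /energyr.
by move: Ex; case: (E x).
Qed.

(** Transfers the convexity hypothesis to real numbers, with [Wp] the squared plan distance, so that
    later arguments involve neither measures nor infinite values. *)
Lemma plan_exists om mu0 mu1 : P2 om0 om -> finite_energy mu0 -> finite_energy mu1 ->
  exists Wp : R,
  [/\ (W2sqr mu0 mu1 <= Wp)%R,
      (Num.sqrt Wp <= Num.sqrt (W2sqr om mu0) + Num.sqrt (W2sqr om mu1))%R &
   forall a : R, (0 < a < 1)%R -> exists mua : P,
     [/\ finite_energy mua,
        (W2sqr om mua + a * (1 - a) * Wp <= (1 - a) * W2sqr om mu0 + a * W2sqr om mu1)%R &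
        (energyr mua <= (1 - a) * energyr mu0 + a * energyr mu1
           - a * (1 - a) * lam / 2 * Wp)%R]].
Proof.
move=> hom [h0 E0] [h1 E1].
have [w [pw cw]] := E_convex h0 h1 hom.
have W0 := W2sqE hom h0; have W1 := W2sqE hom h1.
have Wtri e : (0 < e)%R ->
    W2plan_sq w <= ((1 + e) * W2sqr om mu0 + (1 + e^-1) * W2sqr om mu1)%:E.
  by move=> e0; rewrite EFinD !EFinM -W0 -W1; exact: W2plan_triangle.
have Wp0 : 0 <= W2plan_sq w by apply: le_trans (W2sq_le_W2plan pw); exact: W2sq_ge0.
have Wpfin : W2plan_sq w \is a fin_num.
  by rewrite ge0_fin_numE//; exact: (le_lt_trans (Wtri 1%R ltr01) (ltry _)).
have WpE := fineK Wpfin; set Wp := fine _ in WpE.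
exists Wp; split.
- by have := W2sq_le_W2plan pw; rewrite (W2sqE h0 h1) -WpE lee_fin.
- apply: sqrt_le_of_young; [exact: W2sqr_ge0|exact: W2sqr_ge0|].
  by move=> e e0; have := Wtri e e0; rewrite -WpE lee_fin.
- move=> a /andP[a0 a1].
  have a01 : (0 <= a <= 1)%R by rewrite !ltW.
  have [mua muaE] := interp_law_exists w a.
  have muaE' A : measurable A -> mua A = pushforward w (interp a) A by [].
  have := W2sq_interp pw a01 muaE'; rewrite W0 W1 -WpE => hW.
  (* Convexity speaks only of interpolants in [P2 om0], so finiteness of their distance to the base
     must come first. *)
  have hWfin : W2sq om mua < +oo.
    apply: le_lt_trans (ltry ((1 - a) * W2sqr om mu0 + a * W2sqr om mu1)).
    rewrite EFinD !EFinM; apply: le_trans hW; rewrite leeDl//.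
    by rewrite WpE mule_ge0// lee_fin mulr_ge0// ?subr_ge0 ltW.
  have hmua := P2_near hom hWfin.
  have := cw a a01 mua hmua muaE'.
  rewrite (energyE (conj h0 E0)) (energyE (conj h1 E1)) -WpE -!EFinM -EFinD => hE.
  have dmua' : finite_energy mua by split => //; exact: le_lt_trans hE (ltry _).
  exists mua; split => //.
  + by move: hW; rewrite (W2sqE hom hmua) -!EFinM -!EFinD lee_fin.
  + by move: hE; rewrite energyE.
Qed.

(** Take a plan from [x] to [z] with base the middle point [y]: its [Wp] lies between the two
    sides. *)
Lemma W2sqr_triangle x y z : finite_energy x -> finite_energy y -> finite_energy z ->
  (Num.sqrt (W2sqr x z) <= Num.sqrt (W2sqr x y) + Num.sqrt (W2sqr y z))%R.
Proof.
move=> dx dy dz; have [Wp [le tri _]] := plan_exists dy.1 dx dz.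
by apply: le_trans (ler_wsqrtr le) _; rewrite /W2sqr W2sqC.
Qed.

Lemma prox_evi (tau : R) x y : (0 < tau)%R -> (0 < 1 + lam * tau)%R ->
  P2 om0 x -> finite_energy y -> is_prox om0 E tau x y ->
  forall v, finite_energy v ->
  ((1 + lam * tau) * W2sqr y v <= W2sqr x v - W2sqr x y + 2 * tau * (energyr v - energyr y))%R.
Proof.
move=> tau0 lt0 hx dy [_ prox] v dv.
have [Wp [le _ interp]] := plan_exists hx dy dv.
apply: (@le_trans _ _ ((1 + lam * tau) * Wp)%R); first by rewrite ler_pM2l.
(* Minimality against the interpolant at [a], divided by [a], gives the claim up to the factor
   [1 - a] on the left. *)
apply: (@le_of_small_perturbation _ _ ((1 + lam * tau) * Wp)%R _ 1%R) => // a a01.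
have /andP[a0 a1] := a01.
have [mua [dmua hD hE]] := interp a a01.
have := prox mua dmua.1.
rewrite (W2sqE hx dy.1) (W2sqE hx dmua.1) !energyE// -!EFinM -!EFinD lee_fin.
have tt0 : (0 < 2 * tau)%R by lra.
have ttn0 : (2 * tau)%R != 0%R by rewrite gt_eqF.
move=> /(ler_wpM2l (ltW tt0)); rewrite !mulrDr !(mulVKf ttn0) => hP.
rewrite -(ler_pM2l a0).
have hE' := ler_wpM2l (ltW tt0) hE.
move: hP hE' hD.
have -> : (2 * tau * ((1 - a) * energyr y + a * energyr v - a * (1 - a) * lam / 2 * Wp) =
  2 * tau * energyr y + a * (2 * tau * (energyr v - energyr y))
  - lam * tau * (a * (1 - a) * Wp))%R by field.
have -> : (a * ((1 + lam * tau) * Wp - a * ((1 + lam * tau) * Wp)) =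
  a * (1 - a) * Wp + lam * tau * (a * (1 - a) * Wp))%R by ring.
rewrite !mulrDr !mulrN; lra.
Qed.

(** All quotients are nonnegative, so a negative supremum can only be that of an empty set, namely
    [-oo]; a real value [S] rules this out. *)
Lemma slope_ge0 mu (S : R) : slope om0 E mu = S%:E -> (0 <= S)%R.
Proof.
move=> sE; rewrite leNgt; apply/negP => S0.
have : slope om0 E mu < 0 by rewrite sE lte_fin.
move=> /ereal_inf_lt[_ [delta delta0 <-]] hs.
have : slope om0 E mu <= ereal_sup [set maxe (E mu - E nu) 0 * ((fine (W2 mu nu))^-1)%:E
   | nu in [set nu | P2 om0 nu /\ 0 < W2 mu nu < delta%:E]].
  by apply: ereal_inf_lbound; exists delta.
suff -> : [set maxe (E mu - E nu) 0 * ((fine (W2 mu nu))^-1)%:E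
   | nu in [set nu | P2 om0 nu /\ 0 < W2 mu nu < delta%:E]] = set0.
  by rewrite ereal_sup0 sE.
rewrite -subset0 => _ [nu [h /andP[W0 W1]] <-] /=.
suff : 0 <= ereal_sup [set maxe (E mu - E nu) 0 * ((fine (W2 mu nu))^-1)%:E
   | nu in [set nu | P2 om0 nu /\ 0 < W2 mu nu < delta%:E]].
  by rewrite leNgt hs.
apply: (@le_trans _ _ (maxe (E mu - E nu) 0 * ((fine (W2 mu nu))^-1)%:E)).
  rewrite mule_ge0//; first by rewrite le_max lexx orbT.
  by rewrite lee_fin invr_ge0 fine_ge0// ltW.
by apply: ereal_sup_ubound; exists nu => //; split => //; rewrite W0.
Qed.

(** Convexity makes the local slope global: the slope is tested at interpolants from [mu] to [v]
    close to [mu], and convexity bounds their energy by that of [v]. *)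
Lemma slope_global mu (S : R) : finite_energy mu -> slope om0 E mu = S%:E ->
  forall v, finite_energy v ->
  (energyr mu - energyr v <= S * Num.sqrt (W2sqr mu v) - lam / 2 * W2sqr mu v)%R.
Proof.
move=> dmu sE v dv; have S0 := slope_ge0 sE.
have [Wp [le tri interp]] := plan_exists dmu.1 dmu dv.
have Dmumu : W2sqr mu mu = 0%R by rewrite /W2sqr W2sqxx.
(* The base is [mu] itself, so the plan distance collapses to the Wasserstein distance. *)
have WpE : Wp = W2sqr mu v.
  apply/eqP; rewrite eq_le le andbT.
  move: tri; rewrite Dmumu sqrtr0 add0r ler_sqrt//; exact: W2sqr_ge0.
rewrite WpE in interp.
have r0 := sqrtr_ge0 (W2sqr mu v); have rE := sqr_sqrtr (W2sqr_ge0 mu v).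
set r := Num.sqrt (W2sqr mu v) in r0 rE *.
suff main e : (0 < e)%R -> (energyr mu - energyr v + lam / 2 * W2sqr mu v <= (S + e) * r)%R.
  rewrite lerBrDr; apply: (@le_of_small_perturbation _ _ r _ 1%R) => // e /andP[e0 _].
  by have := main e e0; rewrite mulrDl; lra.
move=> e0.
have : slope om0 E mu < (S + e)%:E by rewrite sE lte_fin; lra.
move=> /ereal_inf_lt[_ [delta /= delta0 <-]] hs.
(* Below this threshold the interpolant, at distance at most [a * r], lies in the [delta]-ball; the
   [+ 1] covers [r = 0]. *)
have a00 : (0 < Num.min 1 (delta / (r + 1)))%R.
  by rewrite lt_min ltr01 divr_gt0//; lra.
apply: (@le_of_small_perturbation _ _ (lam / 2 * W2sqr mu v)%R _ _ a00) => a /andP[a0].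
rewrite lt_min => /andP[a1]; rewrite ltr_pdivlMr; last by lra.
move=> ad.
have [mua [dmua hD hE]] := interp a (introT andP (conj a0 a1)).
set rho := Num.sqrt (W2sqr mu mua).
have rho0 : (0 <= rho)%R by exact: sqrtr_ge0.
have rhoE : (rho ^+ 2 = W2sqr mu mua)%R by rewrite sqr_sqrtr// W2sqr_ge0.
have rho_le : (rho <= a * r)%R.
  have ar0 : (0 <= a * r)%R by apply: mulr_ge0 => //; exact: ltW.
  rewrite -[leRHS]ger0_norm// -sqrtr_sqr; apply: ler_wsqrtr; rewrite exprMn rE.
  by move: hD; rewrite Dmumu; lra.
suff hm : (energyr mu - energyr mua <= (S + e) * (a * r))%R.
  rewrite -(ler_pM2l a0); move: hE hm.
  have -> : (a * (1 - a) * lam / 2 * W2sqr mu v =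
    a * (lam / 2 * W2sqr mu v) - a * (a * (lam / 2 * W2sqr mu v)))%R by field.
  have -> : ((S + e) * (a * r) = a * ((S + e) * r))%R by ring.
  rewrite !mulrDr !mulrN; lra.
have Se : (0 <= S + e)%R by lra.
(* At distance zero the slope gives no information; lower semicontinuity compares the energies
   instead. *)
have [rho00|rhon0] := eqVneq rho 0%R.
  suff : (energyr mu <= energyr mua)%R.
    by have : (0 <= (S + e) * (a * r))%R; [rewrite !mulr_ge0// ltW|lra].
  rewrite leNgt; apply/negP => lt.
  have ltE : (energyr mua)%:E < E mu by rewrite energyE// lte_fin.
  have [dl [dl0 /(_ mua dmua.1)]] := E_lsc dmu.1 ltE.
  rewrite (W2E dmu.1 dmua.1) -/rho rho00 lte_fin => /(_ dl0).
  by rewrite energyE// ltxx.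
have rhop : (0 < rho)%R by rewrite lt0r rhon0.
apply: (@le_trans _ _ ((S + e) * rho)%R); last by rewrite ler_wpM2l.
rewrite -ler_pdivrMr// -lee_fin; apply: le_trans (ltW hs).
apply: (@le_trans _ _ (maxe (E mu - E mua) 0 * ((fine (W2 mu mua))^-1)%:E)); last first.
  apply: ereal_sup_ubound; exists mua => //; split; first exact: dmua.1.
  rewrite (W2E dmu.1 dmua.1) !lte_fin -/rho rhop/=.
  by apply: (le_lt_trans rho_le); lra.
rewrite (W2E dmu.1 dmua.1) !energyE// -EFinB EFinM; apply: lee_wpmul2r.
  by rewrite lee_fin invr_ge0.
by rewrite le_max lexx.
Qed.

(** Testing minimality against the previous iterate shows that the energy does not increase. *)
Lemma JKO_finite_energy (tau : R) mu s : (0 < tau)%R -> finite_energy mu -> is_JKO_seq om0 E tau mu s ->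
  forall n, finite_energy (s n).
Proof.
move=> tau0 dmu [s0 sS]; elim=> [|n IH]; first by rewrite s0.
have [hn prox] := sS n; split=> //.
have := prox _ IH.1; rewrite W2sqxx mule0 add0e (W2sqE IH.1 hn) -EFinM.
move=> /le_lt_trans/(_ IH.2).
by have := E_notNy hn; case: (E (s n.+1)) => // r _ _; rewrite ltry.
Qed.

End functional.

Lemma lam_minus_mul_lt1 (R : realType) (lam tau : R) :
  tau%:E < inv_lam_minus lam -> (lam_minus lam * tau < 1)%R.
Proof.
rewrite /inv_lam_minus; case: eqP => [->|/eqP k0]; first by rewrite mul0r.
have kp : (0 < lam_minus lam)%R by rewrite lt0r k0 le_max lexx.
by rewrite lte_fin -(ltr_pM2l kp) mulfV.
Qed.

Theorem theorem2p6 (R : realType) (d : nat) (om0 : probability (Rd R d) R)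
  (E : probability (Rd R d) R -> \bar R) (lam : R) :
  values_in_Rpinfty om0 E ->
  E_proper om0 E -> coercive om0 E -> W2_lsc om0 E ->
  convex_gen_geod om0 lam E ->
  forall mu : probability (Rd R d) R, in_dom_slope om0 E mu ->
  forall h tau : R, (0 < h)%R -> (h <= tau)%R -> tau%:E < inv_lam_minus lam ->
  forall (n m : nat) (sJ sH : nat -> probability (Rd R d) R),
    is_JKO_seq om0 E tau mu sJ -> is_JKO_seq om0 E h mu sH ->
    W2sq (sJ n) (sH m) <=
      (((n%:R * tau - m%:R * h) ^+ 2 + tau * h * m%:R + 2 * tau ^+ 2 * n%:R)
        * (1 - lam_minus lam * tau) ^- (2 * n)
        * (1 - lam_minus lam * h) ^- (2 * m))%:E
      * (slope om0 E mu * slope om0 E mu).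
Proof.
move=> E_notNy _ _ E_lsc E_convex mu [mu2 Emu slmu] h tau h0 htau tau_lt n m sJ sH JJ JH.
have tau0 : (0 < tau)%R by exact: lt_le_trans htau.
have k0 : (0 <= lam_minus lam)%R by rewrite le_max lexx.
have kl : (- lam <= lam_minus lam)%R by rewrite le_max lexx orbT.
have ktau := lam_minus_mul_lt1 tau_lt.
set k := lam_minus lam in k0 kl ktau *.
have dmu : finite_energy om0 E mu by [].
have dJ := JKO_finite_energy E_notNy tau0 dmu JJ.
have dH := JKO_finite_energy E_notNy h0 dmu JH.
have kh : (k * h < 1)%R by apply: le_lt_trans ktau; exact: ler_wpM2l.
case sE : (slope om0 E mu) slmu => [S| |] // _.
  rewrite -!EFinM (W2sqE (dJ n).1 (dH m).1) lee_fin.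
  (* Since [- lam <= k], replacing [lam] by [- k] only weakens the inequality of [prox_evi]. *)
  have evi t x y : (0 < t)%R -> (k * t < 1)%R ->
      finite_energy om0 E x -> finite_energy om0 E y ->
      is_prox om0 E t x y -> evi_step (finite_energy om0 E) (@W2sqr R d) (energyr E) k t x y.
    move=> t0 kt dx dy pxy v dv.
    have klt : (1 - k * t <= 1 + lam * t)%R.
      by rewrite lerD2l -mulNr ler_pM2r//; lra.
    have lt1 : (0 < 1 + lam * t)%R by lra.
    apply: le_trans (prox_evi E_notNy E_convex t0 lt1 dx.1 dy pxy dv).
    by rewrite ler_wpM2r// W2sqr_ge0.
  apply: (@evi_two_step_estimate R _ (finite_energy om0 E) (@W2sqr R d) (energyr E) k
    (@W2sqr_ge0 R d) _ _ (W2sqr_triangle E_notNy E_convex) k0 mu S dmu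
    (slope_ge0 sE)) => //.
  - by move=> x y; rewrite /W2sqr W2sqC.
  - by move=> x; rewrite /W2sqr W2sqxx.
  - move=> v dv; apply: (le_trans (slope_global E_notNy E_lsc E_convex dmu sE dv)).
    by rewrite lerD2l -mulNr ler_wpM2r ?W2sqr_ge0//; lra.
  - exact: JJ.1.
  - by move=> i; apply: evi => //; exact: (JJ.2 i).
  - exact: JH.1.
  - by move=> i; apply: evi => //; exact: (JH.2 i).
(* What remains is slope [-oo], the supremum over an empty set of competitors. Its square is [+oo],
   so the bound is trivial once [c > 0]; when [n = m = 0] both sides are 0. *)
set c := (X in X%:E * _).
have [nm0|nm0] := boolP ((n == 0%N) && (m == 0%N)).
  move: nm0 => /andP[/eqP n0 /eqP m0].
  have c0 : c = 0%R by rewrite /c n0 m0 !(mul0r, mulr0, subr0, addr0, expr0n).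
  by rewrite n0 m0 JJ.1 JH.1 W2sqxx c0 mul0e.
have cp : (0 < c)%R.
  have q0 i : (0 < (1 - k * tau) ^- i)%R by rewrite invr_gt0 exprn_gt0// subr_gt0.
  have p0 i : (0 < (1 - k * h) ^- i)%R by rewrite invr_gt0 exprn_gt0// subr_gt0.
  rewrite /c; apply: mulr_gt0 => //; apply: mulr_gt0 => //.
  have hm : (0 <= tau * h * m%:R)%R by rewrite !mulr_ge0// ltW.
  have hn : (0 <= 2 * tau ^+ 2 * n%:R)%R by rewrite !mulr_ge0// ltW.
  have hs := sqr_ge0 (n%:R * tau - m%:R * h)%R.
  suff : (0 < tau * h * m%:R + 2 * tau ^+ 2 * n%:R)%R by lra.
  move: nm0; rewrite negb_and -!lt0n => /orP[n0|m0].
    by rewrite ltr_wpDl// !mulr_gt0// ltr0n.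
  by rewrite ltr_wpDr// !mulr_gt0// ltr0n.
by rewrite mulNyNy mulry gtr0_sg// mul1e leey.
Qed.
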